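(* Let $b\in\mathbb{C}$ and let $\hat T_4=\hat A\hat A^\dagger$. Then $$\hat T_4\,\hat h_n=(b^2-2n)(b^2-2-2n)\,\hat h_n,\qquad n=0,1,2,\dots$$
   Context: $h_n(x)=\sum_{j=0}^{\lfloor n/2\rfloor}\frac{n!}{(n-2j)!\,j!}x^{n-2j}(-4)^{-j}$, $n\in\mathbb{N}_0$, are the monic Hermite polynomials. The differential operators are $T_2=\partial_x^2-2x\partial_x$, $U=\partial_x+b$, $V=-\partial_x+2x+b$, $$\hat A=T_2+b^2-(x+b)^{-1}U,\qquad \hat A^\dagger=T_2+b^2-V\circ(x+b)^{-1},$$ with products of operators denoting composition. For $n\in\mathbb{N}_0$, $$\hat h_n(x;b)=\hat A h_n=(b^2-2n)h_n(x)-\frac{b\,h_n(x)+n\,h_{n-1}(x)}{x+b},$$ where $n\,h_{n-1}$ is $0$ when $n=0$. *)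

(* Defs.v *)
From HB Require Import structures.
From mathcomp Require Import all_boot all_order all_algebra.
From mathcomp Require Import generic_quotient fraction.
From mathcomp Require Import complex.
From mathcomp Require Import reals.
From mathcomp Require Import ring zify.

Set Implicit Arguments.
Unset Strict Implicit.
Unset Printing Implicit Defensive.

Import GRing.Theory Num.Theory.
Local Open Scope ring_scope.
Local Open Scope quotient_scope.

(* Differential operators with rational coefficients are represented by their
   action on the field F(x) = {fraction {poly F}} of rational functions. *)

Notation "{ 'ratfun' F }" :=
  {fraction {poly F}} (format "{ 'ratfun'  F }").
Notation rpoly p := (FracField.tofrac p).

Section RatFun.
Variable F : numFieldType.
Implicit Types (p q : {poly F}) (f g : {ratfun F}) (b : F) (n : nat).

Definition rconst (c : F) : {ratfun F} := rpoly c%:P.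
Definition rx : {ratfun F} := rpoly 'X.

(* The quotient rule applied to a chosen representative of f; rderiv_frac below
   shows that the result does not depend on the representative. *)
Definition rderiv f : {ratfun F} :=
  let p := \n_(repr f) in let q := \d_(repr f) in
  rpoly (p^`() * q - p * q^`()) / rpoly (q ^+ 2).

Definition hermite n : {poly F} :=
  \sum_(j < n./2.+1)
    (n`!%:R / ((n - 2 * j)`! * j`!)%:R * (- 4%:R) ^- j) *: 'X^(n - 2 * j).

Definition T2 f : {ratfun F} := rderiv (rderiv f) - 2%:R * rx * rderiv f.

Definition Uop b f : {ratfun F} := rderiv f + rconst b * f.

Definition Vop b f : {ratfun F} := - rderiv f + 2%:R * rx * f + rconst b * f.

Definition xbinv b f : {ratfun F} := (rx + rconst b)^-1 * f.

Definition Ahat b f : {ratfun F} :=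
  T2 f + rconst (b ^+ 2) * f - (xbinv b \o Uop b) f.

Definition Ahat_dag b f : {ratfun F} :=
  T2 f + rconst (b ^+ 2) * f - (Vop b \o xbinv b) f.

Definition T4hat b : {ratfun F} -> {ratfun F} := Ahat b \o Ahat_dag b.

Definition hhat b n : {ratfun F} := Ahat b (rpoly (hermite n)).

Lemma rpoly_eq0 p : (rpoly p == 0) = (p == 0).
Proof. exact: tofrac_eq0. Qed.

Lemma rpolyI : injective (@FracField.tofrac {poly F}).
Proof. by move=> p q /eqP; rewrite tofrac_eq => /eqP. Qed.

Lemma denom_neq0 f : \d_(repr f) != 0.
Proof. exact: denom_ratioP. Qed.

Lemma ratfunE f : f = rpoly \n_(repr f) / rpoly \d_(repr f).
Proof.
have d0 := denom_neq0 f.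
apply: (@mulIf _ (rpoly \d_(repr f))); first by rewrite rpoly_eq0.
rewrite mulfVK ?rpoly_eq0 // -{1}[f]reprK.
set r := repr f in d0 *.
rewrite /FracField.tofrac.
unlock.
change (FracField.mul (\pi_{ratfun F} r) (\pi_{ratfun F} (Ratio \d_r 1))
  = \pi_{ratfun F} (Ratio \n_r 1)).
rewrite -FracField.pi_mul; apply/eqmodP.
rewrite /= FracField.equivfE /FracField.mulf.
by rewrite !numden_Ratio ?mulf_neq0 ?oner_neq0 // !mulr1 mulrC.
Qed.

Lemma rderiv_frac p q : q != 0 ->
  rderiv (rpoly p / rpoly q) = rpoly (p^`() * q - p * q^`()) / rpoly (q ^+ 2).
Proof.
move=> q0; rewrite /rderiv; set f := rpoly p / rpoly q.
have := ratfunE f; have := denom_neq0 f.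
move: (\n_(repr f)) (\d_(repr f)) => m d d0 /eqP.
rewrite /f eqr_div ?rpoly_eq0 // -!tofracM => /eqP/rpolyI E.
apply/eqP; rewrite eqr_div ?rpoly_eq0 ?expf_neq0 // -!tofracM; apply/eqP.
congr FracField.tofrac.
have := congr1 (@deriv _) E; rewrite !derivM => E'.
have h1 : (m^`() * q - p^`() * d) = p * d^`() - m * q^`().
  by move/eqP: E'; rewrite -subr_eq0 => /eqP E'; apply/eqP; rewrite -subr_eq0
    -[X in _ == X]oppr0 -E'; apply/eqP; ring.
have -> : (m^`() * d - m * d^`()) * q ^+ 2 =
  (m^`() * q - p^`() * d) * (d * q) + p^`() * q * d ^+ 2 - m * q * d^`() * q.
  by ring.
rewrite h1 -E.
have -> : (p * d^`() - m * q^`()) * (d * q) = p * d * d^`() * q - m * q * d * q^`().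
  by ring.
by rewrite -E; ring.
Qed.

Lemma rderiv_poly p : rderiv (rpoly p) = rpoly p^`().
Proof.
have := rderiv_frac p (oner_neq0 {poly F}).
by rewrite tofrac1 divr1 => ->; rewrite derivC !mulr0 mulr1 subr0 expr1n tofrac1 divr1.
Qed.

Lemma rderivD f g : rderiv (f + g) = rderiv f + rderiv g.
Proof.
rewrite [f]ratfunE [g]ratfunE.
have := denom_neq0 f; have := denom_neq0 g.
move: (\n_(repr f)) (\d_(repr f)) (\n_(repr g)) (\d_(repr g)) => p q r s s0 q0.
rewrite addf_div ?rpoly_eq0 // -!tofracM -tofracD !rderiv_frac ?mulf_neq0 //.
rewrite addf_div ?rpoly_eq0 ?expf_neq0 // -!tofracM -tofracD -exprMn.
by congr (FracField.tofrac _ / _); rewrite derivD !derivM; ring.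
Qed.

Lemma rderivM f g : rderiv (f * g) = rderiv f * g + f * rderiv g.
Proof.
rewrite [f]ratfunE [g]ratfunE.
have := denom_neq0 f; have := denom_neq0 g.
move: (\n_(repr f)) (\d_(repr f)) (\n_(repr g)) (\d_(repr g)) => p q r s s0 q0.
rewrite mulf_div -!tofracM !rderiv_frac ?mulf_neq0 // !mulf_div -!tofracM.
rewrite addf_div ?rpoly_eq0 ?mulf_neq0 ?expf_neq0 // -!tofracM -tofracD.
apply/eqP; rewrite eqr_div ?rpoly_eq0 ?mulf_neq0 ?expf_neq0 ?mulf_neq0 //.
by rewrite -!tofracM !derivM; apply/eqP; congr FracField.tofrac; ring.
Qed.

Lemma coef_hermite n k : (hermite n)`_k =
  if (k <= n)%N && ~~ odd (n - k) then
   n`!%:R / (k`! * (n-k)./2`!)%:R * (- 4%:R) ^- (n-k)./2 else 0.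
Proof.
rewrite /hermite coef_sum; case: ifP => [/andP[kn od]|H].
  have lt : ((n - k)./2 < n./2.+1)%N by rewrite ltnS half_leq ?leq_subr.
  rewrite (bigD1 (Ordinal lt)) //= big1 => [|i ni]; last first.
    rewrite coefZ coefXn; case: eqP => [e|]; last by rewrite mulr0.
    case/negP: ni; apply/eqP/val_inj => /=; have := ltn_ord i; lia.
  rewrite coefZ coefXn addr0.
  have -> : (n - 2 * (n-k)./2 = k)%N by lia.
  by rewrite eqxx mulr1.
rewrite big1 // => i _; rewrite coefZ coefXn; case: eqP => [e|]; last by rewrite mulr0.
have := ltn_ord i; lia.
Qed.

Lemma hermite_deriv n : (hermite n)^`() = n%:R *: hermite n.-1.
Proof.
case: n => [|n]; apply/polyP => k; rewrite coef_deriv coefZ !coef_hermite.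
  by rewrite ltn0 mul0rn mul0r.
rewrite ltnS subSS /=; case: ifP => _; last by rewrite mul0rn mulr0.
rewrite !factS !natrM -[LHS]mulr_natr.
have fk m : (m`!)%:R != 0 :> F by rewrite pnatr_eq0 -lt0n fact_gt0.
have k1 : k.+1%:R != 0 :> F by rewrite pnatr_eq0.
have p4 m : (- 4%:R) ^+ m != 0 :> F by rewrite expf_neq0 // oppr_eq0 pnatr_eq0.
move: (fk k) (fk (n-k)./2) k1 (p4 (n-k)./2).
move: (k`!%:R) ((n-k)./2`!%:R) (k.+1%:R) ((- 4%:R)^+(n-k)./2) => c d e g c0 d0 e0 g0.
by field; rewrite c0 d0 e0 g0.
Qed.

Lemma hermite_ode n : (hermite n)^`()^`() - 2%:R *: ('X * (hermite n)^`()) =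
  - (2%:R * n%:R) *: hermite n.
Proof.
apply/polyP => k; rewrite coefB !coefZ coefXM !coef_deriv.
have -> : (if k == 0 then 0 else (hermite n)`_k.-1.+1 *+ k.-1.+1) = (hermite n)`_k *+ k.
  by case: k.
suff : (hermite n)`_k.+2 *+ k.+2 *+ k.+1 = 2%:R * (k%:R - n%:R) * (hermite n)`_k.
  by move=> ->; rewrite -(mulr_natr _ k); ring.
rewrite !coef_hermite; have [->|nk] := eqVneq k n.
  by rewrite subrr mulr0 mul0r ltnNge leqnSn /= !mul0rn.
have [kn|nk'] := leqP k n; last first.
  have -> : (k.+2 <= n)%N = false by lia.
  by rewrite /= !mul0rn mulr0.
have [od|od] := boolP (odd (n-k)).
  have -> /= : (k.+2 <= n)%N && ~~ odd (n - k.+2) = false by lia.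
  by rewrite !mul0rn mulr0.
have -> /= : (k.+2 <= n)%N && ~~ odd (n - k.+2) by lia.
set j := (n - k.+2)./2.
have -> : ((n-k)./2 = j.+1)%N by rewrite /j; lia.
have -> : n%:R = k%:R + 2%:R * j.+1%:R :> F by rewrite -natrM -natrD; congr (_%:R); rewrite /j; lia.
rewrite !factS !natrM exprS -[X in X *+ k.+1]mulr_natr -[LHS]mulr_natr.
have fk m : (m`!)%:R != 0 :> F by rewrite pnatr_eq0 -lt0n fact_gt0.
have k1 m : m.+1%:R != 0 :> F by rewrite pnatr_eq0.
have p4 m : (- 4%:R) ^+ m != 0 :> F by rewrite expf_neq0 // oppr_eq0 pnatr_eq0.
move: (fk k) (fk j) (k1 j) (k1 k) (k1 k.+1) (p4 j) (k1 3).
move: (k`!%:R) (j`!%:R) (j.+1%:R) (k.+1%:R) (k.+2%:R) ((- 4%:R)^+j) => c d e f g l c0 d0 e0 f0 g0 l0 f4.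
by field; rewrite c0 d0 e0 f0 g0 l0 ?pnatr_eq0.
Qed.
Lemma rderiv_hermite n : rderiv (rpoly (hermite n)) = n%:R * rpoly (hermite n.-1).
Proof. by rewrite rderiv_poly hermite_deriv scaler_nat tofracMn mulr_natl. Qed.

Lemma T2_hermite n : T2 (rpoly (hermite n)) = - (2%:R * n%:R) * rpoly (hermite n).
Proof.
rewrite /T2 !rderiv_poly /rx.
have e2 : 2%:R = rpoly (2%:R%:P) :> {ratfun F} by rewrite polyC_natr tofracMn tofrac1.
have en : - (2%:R * n%:R) = rpoly ((- (2%:R * n%:R))%:P) :> {ratfun F}.
  by rewrite polyCN polyCM !polyCMn tofracN tofracM !tofracMn tofrac1.
by rewrite en {1}e2 -!tofracM -tofracB -mulrA !mul_polyC hermite_ode.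
Qed.

Lemma xb_neq0 b : rx + rconst b != 0.
Proof. by rewrite /rx /rconst -tofracD rpoly_eq0 -size_poly_eq0 size_XaddC. Qed.

(* The explicit form of hhat; for n = 0 the term n h_(n-1) vanishes. *)
Lemma hhatE b n : hhat b n =
  rconst (b ^+ 2 - 2%:R * n%:R) * rpoly (hermite n)
  - (rconst b * rpoly (hermite n) + n%:R * rpoly (hermite n.-1))
    / (rx + rconst b).
Proof.
rewrite /hhat /Ahat T2_hermite /= /xbinv /Uop rderiv_hermite.
have -> : rconst (b ^+ 2 - 2%:R * n%:R) = rconst (b ^+ 2) - 2%:R * n%:R.
  by rewrite /rconst polyCB (polyCM 2%:R) !polyC_natr tofracB tofracM !tofracMn tofrac1.
by ring.
Qed.

End RatFun.

(* Main.v *)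
Require Import Defs.
From mathcomp Require Import all_boot all_order all_algebra.
From mathcomp Require Import complex reals.
From mathcomp Require Import fraction ring.

Import GRing.Theory Num.Theory.
Local Open Scope ring_scope.
Local Open Scope complex_scope.

(** Put [T = T2 + b^2] and [w = 1/(x+b)].  The derivatives of order three and
    more cancel in [T w U + V w T - V w^2 U], which is just [2 T]; hence
    [Ahat_dag Ahat = T (T - 2)].  Since [T h_n = (b^2 - 2n) h_n], applying the
    linear operator [Ahat] to [Ahat_dag Ahat h_n] gives the eigenvalue of
    [Ahat Ahat_dag] at [Ahat h_n]. *)

Section Derivation.
Variables (K : fieldType) (D : K -> K).
Hypothesis derivationD : forall f g, D (f + g) = D f + D g.
Hypothesis derivationM : forall f g, D (f * g) = D f * g + f * D g.

Lemma derivation0 : D 0 = 0.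
Proof. by apply: (addrI (D 0)); rewrite -derivationD !addr0. Qed.

Lemma derivation1 : D 1 = 0.
Proof.
by apply: (addrI (D 1)); rewrite -{3}[1]mulr1 derivationM mulr1 mul1r addr0.
Qed.

Lemma derivationN f : D (- f) = - D f.
Proof. by apply/eqP; rewrite -addr_eq0 -derivationD addNr derivation0. Qed.

Lemma derivation_nat n : D n%:R = 0.
Proof.
elim: n => [|n IHn]; first exact: derivation0.
by rewrite -natr1 derivationD IHn derivation1 addr0.
Qed.

Lemma derivationV f : f != 0 -> D f^-1 = - D f * (f^-1 * f^-1).
Proof.
move=> f0; have := derivationM f f^-1.
rewrite mulfV // derivation1 => /esym/eqP; rewrite addrC addr_eq0 => /eqP E.
by apply: (mulfI f0); rewrite E; field.
Qed.

(** Over an abstract derivation the operator identity becomes rational arithmetic in [x], [b], [f]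
    and the iterated derivatives of [f]. Here [g] plays the role of [Ahat f]. *)
Lemma derivation_factorization x b f (w := (x + b)^-1)
    (T := fun g => D (D g) - 2%:R * x * D g + b ^+ 2 * g) :
    D x = 1 -> D b = 0 -> x + b != 0 ->
  let g := T f - w * (D f + b * f) in
  T g - (- D (w * g) + 2%:R * x * (w * g) + b * (w * g)) = T (T f) - 2%:R * T f.
Proof.
move=> Dx Db xb0 g.
have Dw : D w = - (w * w).
  by rewrite /w derivationV // derivationD Dx Db addr0 mulN1r.
have D2 := derivation_nat 2.
set f1 := D f; set f2 := D f1; set f3 := D f2.
(* Equivalently [D (T h) = T (D h) - 2 D h]: the commutator comes from differentiating the
   coefficient [2 x]. *)
have DT h : D (T h) =
    D (D (D h)) - 2%:R * D h - 2%:R * x * D (D h) + b ^+ 2 * D h.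
  rewrite /T expr2 !(D2, Dx, Db, derivationD, derivationN, derivationM).
  ring.
have Dg : D g = D (T f) - w * (f2 + b * f1) + w * w * (f1 + b * f).
  rewrite /g !(Db, Dw, D2, derivationD, derivationN, derivationM) -/f1 -/f2.
  ring.
have DDg : D (D g) = D (D (T f)) - w * (f3 + b * f2)
    + 2%:R * (w * w) * (f2 + b * f1) - 2%:R * (w * w * w) * (f1 + b * f).
  rewrite Dg !(Db, Dw, D2, derivationD, derivationN, derivationM) -/f1 -/f2 -/f3.
  ring.
rewrite [D (w * g)]derivationM Dw {1}/T DDg Dg [T (T f)]/T.
(* [D (D (T f))] enters both sides with coefficient 1, so it stays an atom and no fourth derivative
   is expanded. *)
move: (D (D (T f))) => DDTf; rewrite DT -/f1 -/f2 -/f3 /g /T -/f1 -/f2.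
(* Eliminating [x] builds in the relation [w * (x + b) = 1], leaving [w != 0] as the only side
   condition. *)
have -> : x = w^-1 - b by rewrite /w invrK addrK.
have w0 : w != 0 by rewrite invr_neq0.
by clearbody f3 f2 f1; field.
Qed.

End Derivation.

Section OperatorFactorization.
Variable F : numFieldType.
Implicit Types (f g : {ratfun F}) (b c : F).

Lemma rderiv_const c : rderiv (rconst c) = 0.
Proof. by rewrite /rconst rderiv_poly derivC tofrac0. Qed.

Lemma rderiv_rx : rderiv (rx F) = 1.
Proof. by rewrite /rx rderiv_poly derivX tofrac1. Qed.

Lemma rconst_nat n : rconst n%:R = n%:R :> {ratfun F}.
Proof. by rewrite /rconst polyC_natr tofracMn tofrac1. Qed.

Lemma rconstM b c : rconst (b * c) = rconst b * rconst c.
Proof. by rewrite /rconst polyCM tofracM. Qed.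

Lemma rconstB b c : rconst (b - c) = rconst b - rconst c.
Proof. by rewrite /rconst polyCB tofracB. Qed.

(** Constants have derivative zero; this is the part of linearity that carries the eigenvalue
    through [Ahat]. *)
Lemma AhatZ b c f : Ahat b (rconst c * f) = rconst c * Ahat b f.
Proof.
rewrite /Ahat /T2 /xbinv /Uop /= !(rderivD, rderivM, rderiv_const, mul0r, add0r).
ring.
Qed.

Lemma Ahat_dag_Ahat b f (T := fun g => T2 g + rconst (b ^+ 2) * g) :
  Ahat_dag b (Ahat b f) = T (T f) - 2%:R * T f.
Proof.
(* The operators square [b] before embedding it as a constant; the abstract identity squares the
   embedded constant. *)
have b2 : rconst (b ^+ 2) = rconst b ^+ 2 by rewrite expr2 rconstM -expr2.
rewrite /T /Ahat_dag /Ahat /T2 /xbinv /Uop /Vop /= b2.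
exact: (derivation_factorization _ _ (@rderivD F) (@rderivM F) _ _ f
  rderiv_rx (rderiv_const b) (xb_neq0 b)).
Qed.

(** With [l = b^2 - 2n] the eigenvalue of [T] at [h_n], the factorization gives [l (l - 2)]. *)
Lemma Ahat_dag_hhat b n :
  Ahat_dag b (hhat b n) =
  rconst ((b ^+ 2 - 2%:R * n%:R) * (b ^+ 2 - 2%:R - 2%:R * n%:R))
    * rpoly (hermite F n).
Proof.
have T_hermite : T2 (rpoly (hermite F n)) + rconst (b ^+ 2) * rpoly (hermite F n)
    = rconst (b ^+ 2 - 2%:R * n%:R) * rpoly (hermite F n).
  by rewrite T2_hermite rconstB (rconstM 2%:R) !rconst_nat; ring.
have T2Z c f : T2 (rconst c * f) = rconst c * T2 f.
  rewrite /T2 !(rderivD, rderivM, rderiv_const, mul0r, add0r).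
  ring.
rewrite /hhat Ahat_dag_Ahat T_hermite T2Z T2_hermite.
rewrite (rconstM (b ^+ 2 - _)) !rconstB (rconstM 2%:R) !rconst_nat; ring.
Qed.

End OperatorFactorization.

Theorem proposition2p3 (R : realType) (b : R[i]) (n : nat) :
  T4hat b (hhat b n) =
  rconst ((b ^+ 2 - 2%:R * n%:R) * (b ^+ 2 - 2%:R - 2%:R * n%:R)) * hhat b n.
Proof. by rewrite /T4hat /= Ahat_dag_hhat AhatZ. Qed.
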